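(* Let $X$ and $Y$ be discrete, non-deterministic $\mathbb{R}$-valued random variables on the same probability space, taking $a$ and $b$ values with positive probability respectively ($a,b<\infty$). Let $$S_\gamma(X,Y)=\sup_{f,g}\gamma(f(X),g(Y)),$$ where the supremum is over all bijective Borel-measurable functions $f,g:\mathbb{R}\to\mathbb{R}$. Then $$S_\gamma(X,Y)=\max_{s_a\in S_a,\,s_b\in S_b}\gamma(X^{s_a},Y^{s_b}).$$
   Context: Goodman–Kruskal's gamma of real-valued random variables $V,W$ is $$\gamma(V,W)=\frac{\mathbb{P}((V-\tilde V)(W-\tilde W)>0)-\mathbb{P}((V-\tilde V)(W-\tilde W)<0)}{\mathbb{P}((V-\tilde V)(W-\tilde W)>0)+\mathbb{P}((V-\tilde V)(W-\tilde W)<0)},$$ where $(\tilde V,\tilde W)$ is an independent copy of $(V,W)$. $S_m$ is the set of permutations of $\{1,\dots,m\}$. Let $x_1,\dots,x_a$ and $y_1,\dots,y_b$ be the values taken by $X$ and $Y$ with positive probability, listed in an arbitrary but fixed way. For $s_a\in S_a$, $X^{s_a}$ is the random variable equal to $s_a(i)$ when $X=x_i$; for $s_b\in S_b$, $Y^{s_b}$ equals $s_b(j)$ when $Y=y_j$. *)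

(* Defs.v *)
From HB Require Import structures.
From mathcomp Require Import all_boot all_order all_algebra perm.
From mathcomp Require Import all_classical all_reals all_analysis.

Set Implicit Arguments.
Unset Strict Implicit.
Unset Printing Implicit Defensive.

Import Order.TTheory GRing.Theory Num.Theory.
Import numFieldNormedType.Exports.

Local Open Scope classical_set_scope.
Local Open Scope ring_scope.

Section random_variables.
Context {d : measure_display} {T : measurableType d} {R : realType}.
Context {P : probability T R}.

(* The law of X is carried by a countable set; unlike {dRV P >-> R}, the range
   of X may be uncountable, provided the excess has probability zero. *)
Definition discrete (X : {RV P >-> R}) : Prop :=
  exists2 C : set R, countable C & P (X @^-1` C) = 1%E.

Definition deterministic (X : {RV P >-> R}) : Prop :=
  exists c : R, P (X @^-1` [set c]) = 1%E.

Definition lists_atoms (X : {RV P >-> R}) (a : nat) (x : 'I_a -> R) : Prop :=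
  injective x /\ range x = [set r | (0 < P (X @^-1` [set r]))%E].

(* On T * T with the product measure P \x P, the pairs (V w.1, W w.1) and
   (V w.2, W w.2) are independent with the same law: the second one is the
   independent copy of (V, W). *)
Definition concordance (V W : {RV P >-> R}) : R :=
  fine ((P \x P)%E [set w : T * T | 0 < (V w.1 - V w.2) * (W w.1 - W w.2)]).

Definition discordance (V W : {RV P >-> R}) : R :=
  fine ((P \x P)%E [set w : T * T | (V w.1 - V w.2) * (W w.1 - W w.2) < 0]).

Definition gamma (V W : {RV P >-> R}) : R :=
  (concordance V W - discordance V W) / (concordance V W + discordance V W).

Definition S_gamma (X Y : {RV P >-> R}) : \bar R :=
  ereal_sup [set e : \bar R | exists f g : {mfun R >-> R},
    [/\ bijective f, bijective g & e = (gamma (f \o X) (g \o Y))%:E]].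

End random_variables.

Section relabelling.
Context {R : realType}.

(* Permutations act on 'I_a = {0, ..., a - 1}, hence the shift by one. The
   value 0 outside the x i is irrelevant when these carry all the mass. *)
Definition relabel (a : nat) (x : 'I_a -> R) (s : 'S_a) (r : R) : R :=
  if [pick i | r == x i] is Some i then (s i).+1%:R else 0.

Lemma measurable_relabel (a : nat) (x : 'I_a -> R) (s : 'S_a) :
  measurable_fun [set: R] (relabel x s).
Proof.
have mcount (A : set R) : A `<=` range x -> measurable A.
  move=> Ax; apply: countable_measurable => //.
  by apply: finite_set_countable; apply: sub_finite_set Ax _; exact: finite_image.
have off r : ~ range x r -> relabel x s r = 0.
  by rewrite /relabel => nr; case: pickP => // i /eqP ri; case: nr; exists i.
move=> _ B mB; rewrite setTI -[_ @^-1` B](setUIDK _ (range x)).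
apply: measurableU; first by apply: mcount => r [].
have [B0|B0] := pselect (B 0).
- rewrite (_ : _ `\` _ = ~` range x).
    by apply: measurableC; exact: mcount.
  by apply/seteqP; split=> r /=; [case|move=> nr; split=> //; rewrite off].
- rewrite (_ : _ `\` _ = set0); first exact: measurable0.
  by apply/seteqP; split=> r //= [+ /off r0]; rewrite r0.
Qed.

HB.instance Definition _ (a : nat) (x : 'I_a -> R) (s : 'S_a) :=
  isMeasurableFun.Build _ _ _ _ (relabel x s) (measurable_relabel x s).

End relabelling.

Definition relabelled_RV {d : measure_display} {T : measurableType d}
    {R : realType} {P : probability T R} (X : {RV P >-> R}) (a : nat)
    (x : 'I_a -> R) (s : 'S_a) : {RV P >-> R} :=
  relabel x s \o X.

(* Main.v *)
(** Up to null sets, gamma (f X, g Y) depends only on the order in which f lists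
    the atoms of X and g those of Y. Ranking the values f (x i) thus turns f into
    a permutation with the same gamma. Conversely, every order on the atoms is
    realised by a bijective Borel function which permutes them and fixes all
    other reals. *)

From HB Require Import structures.
Require Import Defs.
From mathcomp Require Import all_boot all_order all_algebra perm.
From mathcomp Require Import all_classical all_reals all_analysis.
From mathcomp Require Import measurable_realfun.

Set Implicit Arguments.
Unset Strict Implicit.
Unset Printing Implicit Defensive.

Import Order.TTheory GRing.Theory Num.Theory.
Import numFieldNormedType.Exports.

Local Open Scope classical_set_scope.
Local Open Scope ring_scope.

(** * Rankings of the atoms and the Borel bijections that permute them *)

Section atom_orders.
Context {R : realType}.

(** The rank of [i] is the number [c i] of indices with a strictly smaller value. As [i] never
    counts itself, [c i < a]; as [h] is injective, distinct indices have distinct ranks. *)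
Lemma exists_rank_perm (a : nat) (h : 'I_a -> R) : injective h ->
  exists s : 'S_a, forall i j, (s i < s j)%N = (h i < h j).
Proof.
move=> hinj.
pose c i := #|[set j | h j < h i]%SET|.
have ca i : (c i < a)%N.
  rewrite -[X in (_ < X)%N]card_ord -cardsT; apply: proper_card.
  by apply/properP; split; [apply/fintype.subsetP => k; rewrite inE|exists i; rewrite ?inE ?ltxx].
have cmono i j : h i < h j -> (c i < c j)%N.
  move=> ij; apply: proper_card; apply/properP; split.
    by apply/fintype.subsetP => k; rewrite !inE => /lt_trans; apply.
  by exists i; rewrite !inE ?ltxx.
have cE i j : (c i < c j)%N = (h i < h j).
  case: (ltgtP (h i) (h j)) => [/cmono //|/cmono ji|/hinj ->]; last exact: ltnn.
  by apply/negbTE; rewrite -leqNgt ltnW.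
have rinj : injective (fun i => Ordinal (ca i)).
  move=> i j /(congr1 val) /= cij; apply: hinj.
  by apply/eqP; rewrite eq_le !leNgt -!cE cij ltnn.
by exists (perm rinj) => i j; rewrite !permE /= cE.
Qed.

(** The bijective substitute for [relabel], which sends every point off the list to 0: here those
    points stay fixed. *)
Definition permute_points (a : nat) (x : 'I_a -> R) (s : 'S_a) (r : R) : R :=
  if [pick i | r == x i] is Some i then x (s i) else r.

Lemma permute_points_on (a : nat) (x : 'I_a -> R) (s : 'S_a) (i : 'I_a) :
  injective x -> permute_points x s (x i) = x (s i).
Proof.
move=> xinj; rewrite /permute_points.
by case: pickP => [j /eqP/xinj ->//|/(_ i)]; rewrite eqxx.
Qed.

Lemma permute_points_off (a : nat) (x : 'I_a -> R) (s : 'S_a) (r : R) :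
  ~ range x r -> permute_points x s r = r.
Proof.
rewrite /permute_points => nr; case: pickP => // i /eqP ri.
by case: nr; exists i.
Qed.

Lemma relabel_on (a : nat) (x : 'I_a -> R) (s : 'S_a) (i : 'I_a) :
  injective x -> relabel x s (x i) = (s i).+1%:R.
Proof.
move=> xinj; rewrite /relabel.
by case: pickP => [j /eqP/xinj ->//|/(_ i)]; rewrite eqxx.
Qed.

Lemma permute_pointsK (a : nat) (x : 'I_a -> R) (s : 'S_a) : injective x ->
  cancel (permute_points x s) (permute_points x s^-1%g).
Proof.
move=> xinj r; have [[i _ <-]|nr] := pselect (range x r).
  by rewrite !permute_points_on// permK.
by rewrite !permute_points_off.
Qed.

Lemma bij_permute_points (a : nat) (x : 'I_a -> R) (s : 'S_a) :
  injective x -> bijective (permute_points x s).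
Proof.
move=> xinj; exists (permute_points x s^-1%g); first exact: permute_pointsK.
(* The other cancellation is the same lemma for [s^-1], whose inverse is [s]. *)
by rewrite -{2}[s]invgK; exact: permute_pointsK.
Qed.

Lemma countable_range_ord (a : nat) (x : 'I_a -> R) : countable (range x).
Proof. by apply: finite_set_countable; exact: finite_image. Qed.

Lemma measurable_permute_points (a : nat) (x : 'I_a -> R) (s : 'S_a) :
  measurable_fun [set: R] (permute_points x s).
Proof.
have mcount (A : set R) : A `<=` range x -> measurable A.
  move=> Ax; apply: countable_measurable => //.
  exact: sub_countable (subset_card_le Ax) (countable_range_ord _).
move=> _ B mB; rewrite setTI -[_ @^-1` B](setUIDK _ (range x)).
apply: measurableU; first by apply: mcount => r [].
(* Off the finite set [range x] the map is the identity, so the preimage of [B] there is [B]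
   itself. *)
rewrite (_ : _ `\` _ = B `\` range x).
  by apply: measurableD => //; exact: mcount.
by apply/seteqP; split=> r /= [Br nr]; split=> //;
  move: Br; rewrite permute_points_off.
Qed.

HB.instance Definition _ (a : nat) (x : 'I_a -> R) (s : 'S_a) :=
  isMeasurableFun.Build _ _ _ _ (permute_points x s)
    (measurable_permute_points x s).

Lemma sgrB_eq (u v u' v' : R) :
  (u < v) = (u' < v') -> (v < u) = (v' < u') ->
  Num.sg (u - v) = Num.sg (u' - v').
Proof.
case: (ltgtP u v) => uv; case: (ltgtP u' v') => uv' // _ _.
- by rewrite !ltr0_sg ?subr_lt0.
- by rewrite !gtr0_sg ?subr_gt0.
- by rewrite uv uv' !subrr.
Qed.

End atom_orders.

(** * Invariance of [gamma] under maps that order the atoms alike *)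

Section gamma_order.
Context {d : measure_display} {T : measurableType d} {R : realType}.
Context {P : probability T R}.

Lemma measurable_fun_pair_sign (V W : {RV P >-> R}) :
  measurable_fun [set: T * T]
    (fun w => (V w.1 - V w.2) * (W w.1 - W w.2)).
Proof.
by apply: measurable_funM; apply: measurable_funB;
  apply: measurableT_comp => //.
Qed.

Lemma measurable_concordant (V W : {RV P >-> R}) :
  measurable [set w : T * T | 0 < (V w.1 - V w.2) * (W w.1 - W w.2)].
Proof.
have := measurable_fun_pair_sign V W measurableT (measurable_itv `]0, +oo[).
rewrite setTI; congr measurable.
by apply/seteqP; split=> w /=; rewrite in_itv/= andbT.
Qed.

Lemma measurable_discordant (V W : {RV P >-> R}) :
  measurable [set w : T * T | (V w.1 - V w.2) * (W w.1 - W w.2) < 0].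
Proof.
have := measurable_fun_pair_sign V W measurableT (measurable_itv `]-oo, 0[).
by rewrite setTI; congr measurable; apply/seteqP; split=> w /=; rewrite in_itv.
Qed.

Lemma measure_setI_full (d' : measure_display) (S : measurableType d')
    (mu : probability S R) (A G : set S) :
  measurable A -> measurable G -> mu G = 1%E -> mu (A `&` G) = mu A.
Proof.
move=> mA mG G1; have G0 : mu (~` G) = 0%E.
  by rewrite probability_setC// G1 subee.
rewrite [RHS](measureDI mu mA mG) setDE [X in (X + _)%E](_ : _ = 0%E).
  by rewrite add0e.
apply: (subset_measure0 _ _ _ G0); last exact: subIsetr.
- by apply: measurableI => //; exact: measurableC.
- exact: measurableC.
Qed.

(** The square of [G] has full product measure, and the sign of a product is the product of the
    signs. So on that square both pairs have the same concordant and the same discordant points. *)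
Lemma gamma_eq_on (V W V' W' : {RV P >-> R}) (G : set T) :
  measurable G -> P G = 1%E ->
  (forall s t, G s -> G t -> Num.sg (V s - V t) = Num.sg (V' s - V' t)) ->
  (forall s t, G s -> G t -> Num.sg (W s - W t) = Num.sg (W' s - W' t)) ->
  gamma V W = gamma V' W'.
Proof.
move=> mG G1 hV hW.
have mGG : measurable (G `*` G) by exact: measurableX.
have GG1 : (P \x P)%E (G `*` G) = 1%E by rewrite product_measure1E//= G1 mule1.
have eqGG (A B : set (T * T)) : measurable A -> measurable B ->
    A `&` (G `*` G) = B `&` (G `*` G) -> (P \x P)%E A = (P \x P)%E B.
  move=> mA mB AB.
  by rewrite -(measure_setI_full mA mGG GG1) AB measure_setI_full.
have eqsg w : (G `*` G) w ->
    Num.sg ((V w.1 - V w.2) * (W w.1 - W w.2)) =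
    Num.sg ((V' w.1 - V' w.2) * (W' w.1 - W' w.2)).
  by move=> [G1w G2w]; rewrite !sgrM hV// hW.
have eqC : concordance V W = concordance V' W'.
  congr fine; apply: eqGG; [exact: measurable_concordant..|].
  apply/seteqP; split=> w [/= sw Gw]; split=> //=.
    by rewrite -sgr_gt0 -eqsg// sgr_gt0.
  by rewrite -sgr_gt0 eqsg// sgr_gt0.
have eqD : discordance V W = discordance V' W'.
  congr fine; apply: eqGG; [exact: measurable_discordant..|].
  apply/seteqP; split=> w [/= sw Gw]; split=> //=.
    by rewrite -sgr_lt0 -eqsg// sgr_lt0.
  by rewrite -sgr_lt0 eqsg// sgr_lt0.
by rewrite /gamma eqC eqD.
Qed.

Lemma measurable_preimage_countable (X : {RV P >-> R}) (A : set R) :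
  countable A -> measurable (X @^-1` A).
Proof.
by move=> cA; apply: measurable_funPTI; exact: countable_measurable.
Qed.

Lemma preimage_countable_eq0 (X : {RV P >-> R}) (A : set R) :
  countable A -> (forall r, A r -> P (X @^-1` [set r]) = 0%E) ->
  P (X @^-1` A) = 0%E.
Proof.
(* Either [A] is empty or a sequence [f] enumerates it, and the preimage is a countable union of
   null fibres. *)
move=> cA A0; have [->|[f]] := pfcard_geP cA.
  by rewrite preimage_set0 measure0.
have mA := measurable_preimage_countable X cA.
apply/negligibleP => //.
apply: (@negligibleS _ _ _ _ (\bigcup_k X @^-1` [set f k])).
  by move=> t /= /(@surj _ _ _ _ f) [k _ fk]; exists k.
apply: negligible_bigcup => k; apply/negligibleP.
  by apply: measurable_preimage_countable; exact: countable1.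
by apply: A0; exact: funS.
Qed.

(** The points of the countable carrier [C] that are not atoms are countably many null values, so
    discarding them loses no mass. *)
Lemma discrete_atoms_full (X : {RV P >-> R}) (a : nat) (x : 'I_a -> R) :
  discrete X -> lists_atoms X x ->
  measurable (X @^-1` range x) /\ P (X @^-1` range x) = 1%E.
Proof.
move=> [C cC PC] [_ rx].
have mx := measurable_preimage_countable X (countable_range_ord x).
split => //.
have cD : countable (C `\` range x).
  exact: sub_countable (subset_card_le (@subDsetl _ _ _)) cC.
have D0 : P (X @^-1` (C `\` range x)) = 0%E.
  apply: preimage_countable_eq0 => // r [_]; rewrite rx /= => /negP.
  by rewrite -leNgt measure_le0 => /eqP.
apply/eqP; rewrite eq_le probability_le1//= -PC.
rewrite -[leRHS](measureU0 mx (measurable_preimage_countable X cD) D0).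
rewrite -preimage_setU.
apply: le_measure; rewrite ?inE.
- exact: measurable_preimage_countable.
- rewrite preimage_setU; apply: measurableU => //.
  exact: measurable_preimage_countable.
- by move=> t; have [|] := pselect (range x (X t)); [left|right].
Qed.

Lemma gamma_comp_eq (X Y : {RV P >-> R}) (a b : nat)
    (x : 'I_a -> R) (y : 'I_b -> R) (f f' g g' : {mfun R >-> R}) :
  discrete X -> discrete Y -> lists_atoms X x -> lists_atoms Y y ->
  (forall i j, (f (x i) < f (x j)) = (f' (x i) < f' (x j))) ->
  (forall i j, (g (y i) < g (y j)) = (g' (y i) < g' (y j))) ->
  gamma (P := P) (f \o X) (g \o Y) = gamma (P := P) (f' \o X) (g' \o Y).
Proof.
move=> dX dY hx hy hf hg.
have [mX X1] := discrete_atoms_full dX hx.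
have [mY Y1] := discrete_atoms_full dY hy.
(* Almost surely both variables take listed values, and there the hypotheses on the atoms determine
   all signs. *)
apply: (@gamma_eq_on _ _ _ _ (X @^-1` range x `&` Y @^-1` range y)).
- exact: measurableI.
- by rewrite measure_setI_full.
- by move=> s t [[i _ /= si] _] [[j _ /= tj] _]; rewrite -si -tj; exact: sgrB_eq.
- by move=> s t [_ [i _ /= si]] [_ [j _ /= tj]]; rewrite -si -tj; exact: sgrB_eq.
Qed.

End gamma_order.

(** * Passage between bijections and permutations, and the two inequalities *)

Lemma exists_perm_relabel {R : realType} (a : nat) (x : 'I_a -> R) (f : R -> R) :
  injective x -> injective f -> exists s : 'S_a,
    forall i j, (f (x i) < f (x j)) = (relabel x s (x i) < relabel x s (x j)).
Proof.
move=> xinj finj; have [s hs] := exists_rank_perm (inj_comp finj xinj).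
by exists s => i j; rewrite !relabel_on// ltr_nat ltnS hs.
Qed.

(** If [r] ranks the atoms by size, [x i] must move to the atom of rank [s i], which is
    [x (r^-1 (s i))]. Products of permutations act from left to right, hence [s * r^-1]. *)
Lemma exists_permute_points {R : realType} (a : nat) (x : 'I_a -> R) (s : 'S_a) :
  injective x -> exists t : 'S_a, forall i j,
    (permute_points x t (x i) < permute_points x t (x j)) =
    (relabel x s (x i) < relabel x s (x j)).
Proof.
move=> xinj; have [r hr] := exists_rank_perm xinj.
exists (s * r^-1)%g => i j.
by rewrite !permute_points_on// !relabel_on// ltr_nat ltnS -hr !permM !permKV.
Qed.

Theorem lemma5p4 (d : measure_display) (T : measurableType d) (R : realType)
    (P : probability T R) (X Y : {RV P >-> R})
    (discX : discrete X) (discY : discrete Y)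
    (ndX : ~ deterministic X) (ndY : ~ deterministic Y)
    (a b : nat) (x : 'I_a -> R) (y : 'I_b -> R)
    (hx : lists_atoms X x) (hy : lists_atoms Y y) :
  S_gamma X Y =
  \big[maxe/-oo%E]_(sa : 'S_a) \big[maxe/-oo%E]_(sb : 'S_b)
     (gamma (relabelled_RV X x sa) (relabelled_RV Y y sb))%:E.
Proof.
have [xinj _] := hx; have [yinj _] := hy.
apply/le_anti/andP; split.
(* Each value under the supremum is one of the finitely many terms of the maximum. *)
- apply: ge_ereal_sup => _ [f [g [/bij_inj finj /bij_inj ginj ->]]].
  have [sa hsa] := exists_perm_relabel xinj finj.
  have [sb hsb] := exists_perm_relabel yinj ginj.
  apply: (bigmax_sup sa) => //; apply: (bigmax_sup sb) => //.
  by rewrite (gamma_comp_eq discX discY hx hy hsa hsb).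
(* Conversely, each term of the maximum is attained by a pair of bijections; the initial value [-oo]
   of the iterated maximum is below everything. *)
- apply: bigmax_le => [|sa _]; first exact: leNye.
  apply: bigmax_le => [|sb _]; first exact: leNye.
  have [ta hta] := exists_permute_points sa xinj.
  have [tb htb] := exists_permute_points sb yinj.
  apply: ereal_sup_ubound.
  exists (permute_points x ta), (permute_points y tb).
  split; [exact: bij_permute_points..|].
  by rewrite (gamma_comp_eq discX discY hx hy hta htb).
Qed.
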